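(* Let $\mathbb{F}$ be an infinite field with $\mathrm{char}\,\mathbb{F}\neq 2$, let $V$ be a finite-dimensional vector space over $\mathbb{F}$, and let $Q$ and $Q'$ be quadratic forms on $V$. Then $Q'$ is a contraction of $Q$ if and only if $Q$ represents $Q'$.
   Context: Let $n=\dim V$ and $\mathrm{G}=\mathrm{GL}(V)$. Quadratic forms: for a quadratic form $Q$ on $V$, $B_Q$ is the symmetric bilinear form with $Q(\mathbf{u})=B_Q(\mathbf{u},\mathbf{u})$, and $[B_Q]$ is its matrix relative to a chosen basis of $V$. $\mathrm{G}$ acts on the right on quadratic forms on $V$ by $(Q\mathbf{g})(\mathbf{u})=Q(\mathbf{g}\mathbf{u})$, so $[B_{Q\mathbf{g}}]=\mathbf{g}^{\mathrm{T}}[B_Q]\mathbf{g}$. Two quadratic forms are equivalent, written $\cong$, if they are isometric (for forms on $V$: $Q\cong Q\mathbf{g}$ for $\mathbf{g}\in\mathrm{G}$). A form is nonsingular if its rank (the rank of $[B_Q]$) equals the dimension of its space; a $0$-form is a form of rank $0$, possibly on the space of dimension $0$. $\perp$ denotes orthogonal sum. Every quadratic form $Q$ is equivalent to $Q_N\perp Q_Z$ with $Q_N$ nonsingular and $Q_Z$ a $0$-form, and $Q_N$ is unique up to equivalence. Representation: $Q$ represents $Q'$ if $Q\cong Q'_N\perp Q''$ for some quadratic form $Q''$ (on a space of dimension $\dim V-\mathrm{rank}\,Q'$), where $Q'_N$ is the nonsingular part of $Q'$. Contraction: a contraction family is a one-parameter family $\mathcal{C}=\{\mathbf{g}^t\}$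 of members of $\mathrm{G}$ whose matrix entries (relative to a basis of $V$) are rational functions in $\mathbb{F}(t)$; that is, $\mathbf{g}^t$ is an $n\times n$ matrix over $\mathbb{F}(t)$ with determinant nonzero in $\mathbb{F}(t)$ (it need not be defined or invertible at $t=0$ or at finitely many other values of $t$). For $f\in\mathbb{F}(t)$, $\mathrm{ord} f=\infty$ if $f=0$, and $\mathrm{ord} f=m$ if $f=t^m a(t)/b(t)$ with $a,b$ polynomials, $a(0)\ne0$ and $b(0)\neq 0$; the order of a matrix is the minimum of the orders of its entries. Put $[B^t]=(\mathbf{g}^t)^{\mathrm{T}}[B_Q]\mathbf{g}^t$. If $\mathrm{ord}[B^t]\ge 0$, then $t=0$ can be substituted, giving a matrix $[B^0]$ over $\mathbb{F}$; the corresponding quadratic form $Q^0$ on $V$ is called a contraction of $Q$. Thus $Q'$ is a contraction of $Q$ if $Q'=Q^0$ for some contraction family with $\mathrm{ord}[B^t]\ge0$. (Replacing $\mathbf{g}^t$ by $\mathbf{g}^t\mathbf{h}$ with $\mathbf{h}\in\mathrm{G}$ constant replaces $Q^0$ by $Q^0\mathbf{h}$, so requiring only $Q'\cong Q^0$ gives the same notion.) *)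

(* Defs.v *)
From HB Require Import structures.
From mathcomp Require Import all_boot all_order all_algebra.
From mathcomp Require Import sesquilinear fraction.
From mathcomp Require Import classical_sets cardinality constructive_ereal.

Set Implicit Arguments.
Unset Strict Implicit.
Unset Printing Implicit Defensive.

Import Order.TTheory GRing.Theory Num.Theory.
Local Open Scope ring_scope.

Section QuadraticForms.
Variable F : fieldType.
Implicit Types N V W : vectType F.

Definition quadratic_form V (Q : V -> F) : Prop :=
  exists B : {symmetric V}, forall u, Q u = B u u.

(* Polarization: in characteristic other than 2 this recovers the unique
   symmetric bilinear form B with Q u = B u u (see [bilinE]). *)
Definition bilin V (Q : V -> F) (u v : V) : F :=
  (Q (u + v) - Q u - Q v) / 2.

Lemma bilinE V (Q : V -> F) (B : {symmetric V}) :
  2%N \notin [pchar F] -> (forall u, Q u = B u u) ->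
  forall u v, bilin Q u v = B u v.
Proof.
move=> ch2 QE u v.
have two0 : (2 : F) != 0 by move: ch2; rewrite inE.
have symB : B v u = B u v by rewrite hermC expr0 mul1r.
have DB : B (u + v) (u + v) = B u u + B v u + (B u v + B v v).
  by rewrite linearDr /= !linearDl.
rewrite /bilin !QE DB symB; apply: (canLR (mulfK two0)).
rewrite mulr_natr mulr2n addrA [LHS]addrAC addrK.
by rewrite -[B u u + _ + _]addrA [B u u + _]addrC addrK.
Qed.

Definition gram V n (e : n.-tuple V) (Q : V -> F) : 'M[F]_n :=
  \matrix_(i, j) bilin Q e`_i e`_j.

(* The quadratic form on V whose matrix relative to the basis e is M. *)
Definition form_of_mx V n (e : n.-tuple V) (M : 'M[F]_n) (u : V) : F :=
  let x : 'cV[F]_n := \col_i coord e i u in (x^T *m M *m x) 0 0.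

Definition qrank V (Q : V -> F) : nat := \rank (gram (vbasis {:V}) Q).

Definition nonsingular V (Q : V -> F) : Prop := qrank Q = \dim {:V}.

Definition zero_form V (Q : V -> F) : Prop := qrank Q = 0%N.

Definition equivalent V W (Q1 : V -> F) (Q2 : W -> F) : Prop :=
  exists phi : {linear V -> W}, bijective phi /\ forall u, Q1 u = Q2 (phi u).

Definition orth_sum V W (Q1 : V -> F) (Q2 : W -> F) (p : V * W) : F :=
  Q1 p.1 + Q2 p.2.

Definition nonsingular_part V N (Q : V -> F) (QN : N -> F) : Prop :=
  [/\ quadratic_form QN, nonsingular QN &
      exists (Z : vectType F) (QZ : Z -> F),
        [/\ quadratic_form QZ, zero_form QZ &
            equivalent Q (orth_sum QN QZ)]].

Definition represents V (Q Q' : V -> F) : Prop :=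
  exists (N : vectType F) (Q'N : N -> F) (W : vectType F) (Q'' : W -> F),
    [/\ nonsingular_part Q' Q'N, quadratic_form Q'',
        \dim {:W} = (\dim {:V} - qrank Q')%N &
        equivalent Q (orth_sum Q'N Q'')].

End QuadraticForms.

Local Notation "x %:F" := (@FracField.tofrac _ x) : ring_scope.

Lemma fraction_numden (R : idomainType) (f : {fraction R}) :
  f * (\d_(repr f))%:F = (\n_(repr f))%:F.
Proof.
rewrite -[X in X * _]reprK; move: (repr f) => x.
unlock FracField.tofrac; rewrite -[LHS]FracField.pi_mul; apply/eqmodP => /=.
rewrite FracField.equivfE /FracField.mulf.
by rewrite !numden_Ratio ?mulr1 ?mulf_neq0 ?oner_neq0 ?denom_ratioP // mulrC.
Qed.

Section RationalFunctions.
Variable F : fieldType.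

(* [repr f] is some fraction representing f, not necessarily in lowest terms;
   neither [ord] nor [at0] depends on this choice (see [ordE], [at0E]). *)
Definition ord (f : {fraction {poly F}}) : \bar int :=
  if f == 0 then +oo%E
  else (((mup 0 \n_(repr f))%:Z - (mup 0 \d_(repr f))%:Z)%:E)%E.

(* The value of f at t = 0; meaningful only when 0 <= ord f. *)
Definition at0 (f : {fraction {poly F}}) : F :=
  let k := mup 0 \d_(repr f) in
  (\n_(repr f) %/ 'X^k).[0] / (\d_(repr f) %/ 'X^k).[0].

Lemma frac_repr (f : {fraction {poly F}}) (p q : {poly F}) :
  q != 0 -> f = p%:F / q%:F -> \n_(repr f) * q = \d_(repr f) * p.
Proof.
move=> q0 fE; have q0' : q%:F != 0 :> {fraction {poly F}} by rewrite tofrac_eq0.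
have := fraction_numden f; set n := \n_ _; set d := \d_ _ => fd.
apply/eqP; rewrite -tofrac_eq !tofracM -fd fE mulrAC divfK //; apply/eqP.
exact: mulrC.
Qed.

Lemma mup0_Xn k (p : {poly F}) : p.[0] != 0 -> mup 0 ('X^k * p) = k.
Proof.
by move=> p0; rewrite mupMl // -['X]subr0 -polyC0 mup_XsubCX eqxx.
Qed.

Lemma ord_frac0 : ord 0 = +oo%E.
Proof. by rewrite /ord eqxx. Qed.

Lemma ordE (m : int) (a b : {poly F}) : a.[0] != 0 -> b.[0] != 0 ->
  ord (('X%:F : {fraction {poly F}}) ^ m * (a%:F / b%:F)) = (m%:E)%E.
Proof.
move=> a0 b0.
have nz (p : {poly F}) : p.[0] != 0 -> p != 0.
  by apply: contra_neq => ->; rewrite horner0.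
have main k l : ord (('X^k * a)%:F / ('X^l * b)%:F) = ((k%:Z - l%:Z)%:E)%E.
  set f := _ / _.
  have q0 : 'X^l * b != 0 by rewrite mulf_neq0 ?expf_neq0 ?polyX_eq0 ?nz.
  have p0 : 'X^k * a != 0 by rewrite mulf_neq0 ?expf_neq0 ?polyX_eq0 ?nz.
  have f0 : f != 0 by rewrite mulf_neq0 ?invr_eq0 ?tofrac_eq0.
  have E := frac_repr q0 (erefl f).
  have d0 : \d_(repr f) != 0 by rewrite denom_ratioP.
  have n0 : \n_(repr f) != 0.
    apply: contraTneq f0 => n0; move/eqP: E.
    by rewrite n0 mul0r eq_sym mulf_eq0 (negPf d0) (negPf p0).
  move/(congr1 (mup 0)): E; rewrite (mupM 0 n0 q0) (mupM 0 d0 p0) !mup0_Xn // => E.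
  rewrite /ord (negPf f0); congr (_%:E)%E; apply/eqP.
  rewrite subr_eq addrAC eq_sym subr_eq -!PoszD eqz_nat.
  by rewrite E addnC.
case: m => k.
  rewrite -exprnP mulrA -tofracXn -tofracM.
  by have := main k 0%N; rewrite subr0 expr0 mul1r.
rewrite NegzE -exprnN mulrCA; have := main 0%N k.+1.
by rewrite expr0 mul1r sub0r tofracM tofracXn invfM.
Qed.

Lemma at0E (a b : {poly F}) : b.[0] != 0 -> at0 (a%:F / b%:F) = a.[0] / b.[0].
Proof.
move=> b0; set f := _ / _.
have bn0 : b != 0 by apply: contra_neq b0 => ->; rewrite horner0.
have E := frac_repr bn0 (erefl f).
rewrite /at0; move: E (denom_ratioP (repr f)).
set n := \n_ _; set d := \d_ _; set k := mup 0 d => E d0.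
have Xk_d : 'X^k %| d by rewrite -['X]subr0 -polyC0 -mup_geq.
have Xk_n : 'X^k %| n.
  rewrite -(@Gauss_dvdpl _ _ b) ?E ?dvdp_mulr //.
  by rewrite coprimep_expl // coprimep_sym coprimepX.
have Xk0 : 'X^k != 0 :> {poly F} by rewrite expf_neq0 ?polyX_eq0.
have d'0 : (d %/ 'X^k).[0] != 0.
  apply/negP; rewrite -/(root _ _) root_factor_theorem polyC0 subr0 => dv.
  have : ('X - 0%:P) ^+ k.+1 %| d.
    by rewrite polyC0 subr0 exprSr -(divpK Xk_d) [_ * 'X]mulrC dvdp_mul2r.
  by rewrite -mup_geq // ltnn.
have E' : (n %/ 'X^k) * b = (d %/ 'X^k) * a.
  apply: (mulIf Xk0).
  by rewrite mulrAC divpK // E mulrAC divpK.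
apply/eqP; rewrite eqr_div // -!hornerM E' mulrC; exact/eqP.
Qed.

Definition ord_mx m n (A : 'M[{fraction {poly F}}]_(m, n)) : \bar int :=
  \big[Order.min/+oo%E]_(i < m) \big[Order.min/+oo%E]_(j < n) ord (A i j).

Definition const_frac (c : F) : {fraction {poly F}} := (c%:P)%:F.

End RationalFunctions.

Section Contraction.
Variable F : fieldType.

(* g is the contraction family, written in coordinates relative to the basis e;
   only its determinant over F(t) is required to be nonzero. *)
Definition contraction (V : vectType F) n (e : n.-tuple V)
    (Q Q' : V -> F) : Prop :=
  exists g : 'M[{fraction {poly F}}]_n,
    let Bt := g^T *m map_mx (@const_frac F) (gram e Q) *m g in
    [/\ \det g != 0, (0 <= ord_mx Bt)%E &
        Q' =1 form_of_mx e (map_mx (@at0 F) Bt)].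

End Contraction.

(* Main.v *)
From HB Require Import structures.
Require Import Defs.
From mathcomp Require Import all_boot all_order all_algebra.
From mathcomp Require Import sesquilinear fraction.
From mathcomp Require Import classical_sets cardinality constructive_ereal.
From mathcomp Require Import ring.

Set Implicit Arguments.
Unset Strict Implicit.
Unset Printing Implicit Defensive.

Import Order.TTheory GRing.Theory Num.Theory.
Local Open Scope ring_scope.

(* Both conditions are equivalent to the existence of a constant matrix X, not
   necessarily invertible, with X^T [B_Q] X = [B_Q'].

   From a contraction family g to X: after clearing denominators, the rows of
   (G^T | d) span, over F(t), an n-dimensional isotropic subspace for
   B_Q _|_ (- B^t). Dividing by t as long as the rows are dependent at t = 0, it
   specializes to an n-dimensional isotropic subspace of B_Q _|_ (- B^0) over
   F, spanned by the rows of some (P | R). If R is invertible, then this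
   subspace is the graph of an isometric map, as wanted; otherwise a suitable
   reflection increases the rank of R. This needs B_Q nonsingular, which is
   arranged by splitting off the radical.

   From X to a contraction family: X + t (1 - X) is X at t = 0 and is
   invertible at t = 1.

   Restricting X to a complement of the radical of Q' yields a copy in Q of the
   nonsingular part of Q', whose orthogonal complement is the remaining
   summand. *)

Local Notation "x %:F" := (@FracField.tofrac _ x) : ring_scope.

Lemma mul_mx11 (R : comNzRingType) m n (A : 'M[R]_(m, 1)) (a : 'M[R]_1)
    (B : 'M[R]_(1, n)) : A *m a *m B = a 0 0 *: (A *m B).
Proof. by rewrite {1}[a]mx11_scalar mul_mx_scalar -scalemxAl. Qed.

Lemma symmx_swap (R : comNzRingType) s (B : 'M[R]_s) (x y : 'rV[R]_s) :
  B^T = B -> (x *m B *m y^T) 0 0 = (y *m B *m x^T) 0 0.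
Proof.
move=> BT; have -> : y *m B *m x^T = (x *m B *m y^T)^T.
  by rewrite !trmx_mul trmxK BT mulmxA.
by rewrite [RHS]mxE.
Qed.

(** * Isotropic subspaces and graphs of isometric maps *)

Section Isotropic.
Variable F : fieldType.

(* The rows of (P | R) are reflected in z = (x, w), a vector of norm 1 for
   B _|_ (- C). *)
Lemma reflection_isotropic s n m (B : 'M[F]_s) (C : 'M[F]_n)
    (P : 'M[F]_(m, s)) (R : 'M[F]_(m, n)) (x : 'rV[F]_s) (w : 'rV[F]_n) :
  B^T = B -> C^T = C -> P *m B *m P^T = R *m C *m R^T ->
  (x *m B *m x^T) 0 0 - (w *m C *m w^T) 0 0 = 1 ->
  let b := P *m B *m x^T - R *m C *m w^T in
  (P - 2 *: (b *m x)) *m B *m (P - 2 *: (b *m x))^T =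
  (R - 2 *: (b *m w)) *m C *m (R - 2 *: (b *m w))^T.
Proof.
move=> BT CT PR q1 b.
have ex k (M : 'M[F]_k) (A : 'M[F]_(m, k)) (y : 'rV[F]_k) (a : 'cV[F]_m) :
    M^T = M -> (A - a *m y) *m M *m (A - a *m y)^T =
    A *m M *m A^T - (A *m M *m y^T *m a^T + a *m (A *m M *m y^T)^T) +
    (y *m M *m y^T) 0 0 *: (a *m a^T).
  move=> MT; rewrite linearB /= !trmx_mul -mul_mx11 trmxK MT.
  rewrite mulmxBl mulmxBr !mulmxBl.
  rewrite !mulmxA opprB addrA [LHS]addrAC; congr (_ + _).
  by rewrite opprD addrA [RHS]addrAC.
rewrite !scalemxAl !ex // PR.
apply/eqP; rewrite -subr_eq0; apply/eqP.
have -> : (x *m B *m x^T) 0 0 = 1 + (w *m C *m w^T) 0 0 by rewrite -q1 subrK.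
set p := P *m B *m x^T; set r := R *m C *m w^T.
have -> : p = r + b by rewrite /b addrC subrK.
apply/matrixP=> i j; rewrite ?linearD ?linearZ /= ?(mulmxDl, mulmxDr).
rewrite -?scalemxAl -?scalemxAr !mxE !big_ord1 !mxE.
ring.
Qed.

(** Induction on the dimension of the kernel of [R]. For invertible [R], row reduction turns
    [(P | R)] into [(R^-1 P | 1)], the graph of [X = R^-1 P]; otherwise a reflection lowers that
    dimension and keeps the rows independent. *)
Lemma isotropic_graph s n (B : 'M[F]_s) (C : 'M[F]_n)
    (P : 'M[F]_(n, s)) (R : 'M[F]_n) :
  2%N \notin [pchar F] -> B \in unitmx -> B^T = B -> C^T = C ->
  (forall c : 'rV_n, c *m P = 0 -> c *m R = 0 -> c = 0) ->
  P *m B *m P^T = R *m C *m R^T ->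
  exists X : 'M[F]_(n, s), X *m B *m X^T = C.
Proof.
move=> ch2 uB BT CT.
have two0 : (2 : F) != 0 by move: ch2; rewrite inE.
have [k] := ubnP (\rank (kermx R)).
elim: k P R => // k IH P R; rewrite ltnS => rk inj PR.
have [uR | nuR] := boolP (R \in unitmx).
  exists (invmx R *m P); rewrite trmx_mul !mulmxA.
  rewrite -(mulmxA _ _ B) -(mulmxA _ _ P^T) PR.
  rewrite !mulmxA mulVmx // mul1mx -mulmxA -trmx_mul mulVmx //.
  by rewrite trmx1 mulmx1.
(* Reflecting in z = (x, w), with w outside the row space of R and x not
   orthogonal to u = c P, shrinks the kernel of R: it loses c. *)
have [w wR] : exists w : 'rV_n, ~~ (w <= R)%MS.
  have /row_subPn[i iR] : ~~ (1%:M <= R)%MS by rewrite sub1mx row_full_unit.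
  by exists (row i 1%:M).
have [c cR c0] : exists2 c : 'rV_n, c *m R = 0 & c != 0.
  have /rowV0Pn[c /sub_kermxP cR c0] : kermx R != 0.
    by rewrite kermx_eq0 row_free_unit.
  by exists c.
pose u := c *m P.
(* Since [c R = 0], the vector [(u, 0)] lies in the isotropic row space of [(P | R)]. *)
have uu : u *m B *m u^T = 0.
  by rewrite trmx_mul !mulmxA -(mulmxA c) -(mulmxA c) PR !mulmxA cR !mul0mx.
have uB0 : u *m B != 0.
  apply: contraNneq c0 => uB0; apply/eqP/inj => //.
  by rewrite -[LHS](mulmxK uB) -/u uB0 mul0mx.
have [x1 ux1] : exists x : 'rV_s, (u *m B *m x^T) 0 0 = 1.
  have /rV0Pn[j uj] := uB0.
  exists (((u *m B) 0 j)^-1 *: delta_mx 0 j).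
  by rewrite linearZ /= trmx_delta -scalemxAr -colE mxE [X in _ * X]mxE mulVf.
(* As [u] is isotropic and pairs to 1 with [x1], adding [l u] to [x1] raises its norm by [2 l]; this
   [l] gives [(x, w)] norm 1. *)
pose l := (1 + (w *m C *m w^T) 0 0 - (x1 *m B *m x1^T) 0 0) / 2.
pose x := x1 + l *: u.
have ux : (u *m B *m x^T) 0 0 = 1.
  by rewrite linearD /= linearZ /= mulmxDr -scalemxAr uu scaler0 addr0.
have q1 : (x *m B *m x^T) 0 0 - (w *m C *m w^T) 0 0 = 1.
  have -> : x *m B *m x^T =
      x1 *m B *m x1^T + l *: (x1 *m B *m u^T) + l *: (u *m B *m x^T).
    rewrite {1}/x !mulmxDl -!scalemxAl; congr (_ + _).
    by rewrite linearD /= linearZ /= mulmxDr -scalemxAr.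
  rewrite [X in X - _]mxE [X in X + _ - _]mxE [X in _ + X + _ - _]mxE.
  rewrite [X in _ + _ + X - _]mxE (symmx_swap x1 u BT) ux1 ux !mulr1.
  by rewrite -[_ + l + l]addrA -mulr2n -mulr_natr divfK // addrC subrK addrK.
have := reflection_isotropic BT CT PR q1.
set b := P *m B *m x^T - R *m C *m w^T => /= PR'.
(* If [d] kills the reflected [R], then [d R = 2 (d b) w], and [w] outside the row space of [R]
   forces [d b = 0]. So the new kernel lies in the old one, properly because [c b = u B x^T = 1]. *)
have cb (d : 'rV_n) : d *m (R - 2 *: (b *m w)) = 0 ->
    d *m b = 0 /\ d *m R = 0.
  rewrite mulmxBr -scalemxAr mulmxA => /eqP; rewrite subr_eq0 => /eqP dR.
  suff db : d *m b = 0 by rewrite dR db mul0mx scaler0.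
  apply/eqP; apply: contraNT wR => db0.
  have db : (d *m b) 0 0 != 0.
    by apply: contraNneq db0 => db; rewrite [d *m b]mx11_scalar db raddf0.
  have -> : w = (((d *m b) 0 0)^-1 / 2 *: d) *m R.
    rewrite -scalemxAl dR scalerA divfK // [d *m b]mx11_scalar mul_scalar_mx.
    by rewrite scalerA mxE eqxx mulVf // scale1r.
  exact: submxMl.
apply: IH PR' => [|d dP dR'].
  apply: leq_trans rk; apply: rank_ltmx; apply/andP; split.
    apply/rV_subP => d /sub_kermxP /cb[_ dR]; exact/sub_kermxP.
  apply/rV_subP => /(_ c); rewrite (sameP sub_kermxP eqP) cR => /(_ (eqxx _)).
  case/sub_kermxP/cb => cb0 _; move: ux.
  have -> : u *m B *m x^T = c *m b.
    by rewrite mulmxBr !mulmxA cR !mul0mx subr0.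
  by rewrite cb0 mxE => /eqP; rewrite eq_sym oner_eq0.
have [db dR] := cb d dR'; apply: inj => //.
by move: dP; rewrite mulmxBr -scalemxAr mulmxA db mul0mx scaler0 subr0.
Qed.
End Isotropic.

(** * Specialization of polynomial matrices at t = 0 *)

Section Saturation.
Variable F : fieldType.

Lemma horner_eval_polyC_mx m n (x : F) (A : 'M[F]_(m, n)) :
  map_mx (horner_eval x) (map_mx polyC A) = A.
Proof. by apply/matrixP=> i j; rewrite !mxE /horner_eval hornerC. Qed.

Lemma mulmx_det_eq0 (R : idomainType) n m (D : 'M[R]_n) (A : 'M[R]_(n, m)) :
  \det D != 0 -> D *m A = 0 -> A = 0.
Proof.
move=> D0 /(congr1 (mulmx (\adj D))).
rewrite mulmx0 mulmxA mul_adj_mx mul_scalar_mx => dA.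
apply/matrixP=> i j; move/matrixP: dA => /(_ i j); rewrite !mxE => /eqP.
by rewrite mulf_eq0 (negPf D0) => /eqP.
Qed.

(** While the rows are dependent at 0, some constant combination of them is divisible by ['X].
    Dividing it out strips a factor ['X] from the nonzero determinant of [P W], so the process
    stops; [D] records the row operations. *)
Lemma saturate_mx n m (P : 'M[{poly F}]_(n, m)) (W : 'M[{poly F}]_(m, n)) :
  \det (P *m W) != 0 ->
  exists (D : 'M[{poly F}]_n) (P' : 'M[{poly F}]_(n, m)),
    [/\ \det D != 0, P = D *m P' & row_free (map_mx (horner_eval 0) P')].
Proof.
have [k] := ubnP (size (\det (P *m W))).
elim: k P => // k IH P; rewrite ltnS => szP PW.
have [fP | nfP] := boolP (row_free (map_mx (horner_eval 0) P)).
  by exists 1%:M, P; rewrite det1 oner_neq0 mul1mx.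
(* Scaling one coordinate of [c] to 1 makes the replacement of that row by [c P] unimodular. *)
have [c [j [cP cj]]] : exists (c : 'rV[F]_n) j,
    c *m map_mx (horner_eval 0) P = 0 /\ c 0 j = 1.
  move: nfP; rewrite -kermx_eq0 => /rowV0Pn[c /sub_kermxP cP /rV0Pn[j cj]].
  by exists ((c 0 j)^-1 *: c), j; rewrite -scalemxAl cP scaler0 mxE mulVf.
(* 1 + a b replaces the j-th row of P by c P, which vanishes at 0; its inverse
   is 1 - a b, since b a = 0. *)
pose cp := map_mx polyC c.
pose a : 'cV[{poly F}]_n := delta_mx j 0.
pose b := cp - delta_mx 0 j.
have ba : b *m a = 0.
  rewrite mulmxBl mul_delta_mx -colE; apply/matrixP => i k'; rewrite !mxE !ord1.
  by rewrite cj subrr.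
pose P1 := \matrix_(i, l) (if i == j then (cp *m P) 0 l %/ 'X else P i l).
pose T := diag_mx (\row_i (if i == j then 'X else 1 : {poly F})).
have TP1 : T *m P1 = (1%:M + a *m b) *m P.
  rewrite mul_diag_mx mulmxDl mul1mx -mulmxA mulmxBl -rowE.
  apply/matrixP => i l; rewrite [LHS]mxE ![X in X * _]mxE [P1 _ _]mxE.
  rewrite [RHS]mxE [X in _ + X]mxE big_ord1 !(mxE delta_mx_key) eqxx andbT.
  case: eqP => [->|_]; last by rewrite mul0r addr0 mul1r.
  rewrite mul1r [X in _ + X]mxE [X in _ + (_ + X)]mxE [X in _ - X]mxE.
  rewrite addrC subrK mulrC divpK //.
  rewrite -['X]subr0 -polyC0 dvdp_XsubCl; apply/rootP.
  have /matrixP/(_ 0 l) := congr1 (map_mx (horner_eval 0)) (erefl (cp *m P)).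
  by rewrite {2}map_mxM horner_eval_polyC_mx cP !mxE.
have P_E : P = ((1%:M - a *m b) *m T) *m P1.
  rewrite -mulmxA TP1 mulmxA mulmxDr mulmx1 mulmxBl mul1mx mulmxA -(mulmxA a b).
  by rewrite ba mulmx0 mul0mx subr0 subrK mul1mx.
have detT : \det T = 'X.
  rewrite det_diag (bigD1 j) //= big1 ?mulr1 ?mxE ?eqxx // => i ij.
  by rewrite mxE (negPf ij).
have PW1 : \det (P *m W) = \det (1%:M - a *m b) * ('X * \det (P1 *m W)).
  by rewrite {1}P_E -(mulmxA _ P1) !det_mulmx detT mulrA.
have [D1 D0] : \det (1%:M - a *m b) != 0 /\ \det (P1 *m W) != 0.
  move: PW; rewrite PW1 !mulf_eq0 !negb_or => /and3P[]//.
have [] := IH P1 => //.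
  apply: leq_trans szP; rewrite PW1.
  rewrite size_mul ?mulf_neq0 ?polyX_eq0 //.
  rewrite [size ('X * _)]size_mul ?polyX_eq0 //.
  rewrite size_polyX -(prednK (_ : 0 < size (\det (1%:M - a *m b)))%N);
    last by rewrite lt0n size_poly_eq0.
  by rewrite addSn /= addSn leq_addl.
move=> D [P' [D'0 PE fP']]; exists ((1%:M - a *m b) *m T *m D), P'; split=> //.
  by rewrite !det_mulmx detT !mulf_neq0 ?polyX_eq0.
by rewrite {1}P_E PE mulmxA.
Qed.

(** In the application [G^T] is [d] times the family and [A] is [b] times B^t. Isotropy of the rows
    of [(G | d)] passes to the saturated rows [(P | R)], and from there to their values at 0. *)
Lemma graph_of_contraction s n (B : 'M[F]_s) (C : 'M[F]_n)
    (G : 'M[{poly F}]_(n, s)) (A : 'M[{poly F}]_n) (b d : {poly F}) :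
  2%N \notin [pchar F] -> B \in unitmx -> B^T = B -> C^T = C ->
  d != 0 -> b.[0] != 0 ->
  b *: (G *m map_mx polyC B *m G^T) = d ^+ 2 *: A ->
  map_mx (horner_eval 0) A = b.[0] *: C ->
  exists X : 'M[F]_(n, s), X *m B *m X^T = C.
Proof.
move=> ch2 uB BT CT d0 b0 GA A0.
(* The chosen [W] selects the block [d%:M], whose determinant is a power of [d]. *)
have [] := @saturate_mx _ _ (row_mx G d%:M) (col_mx 0 1%:M).
  by rewrite mul_row_col mulmx0 add0r mulmx1 det_scalar expf_neq0.
move=> D [P' [D0 PE fP']]; move: PE fP'; rewrite -[P']hsubmxK.
move: (lsubmx P') (rsubmx P') => {P'} P R.
rewrite mul_mx_row => /eq_row_mx[GE dE] fPR.
(* Substituting [G = D P] and [d = D R] gives the identity multiplied by [D] on the left and [D^T]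
   on the right; both cancel, the second after transposing. *)
have PAR : b *: (P *m map_mx polyC B *m P^T) = R *m A *m R^T.
  apply/eqP; rewrite -subr_eq0; apply/eqP.
  apply: (mulmx_det_eq0 D0); apply: trmx_inj; rewrite trmx0.
  apply: (mulmx_det_eq0 D0); apply: trmx_inj; rewrite trmx0 trmx_mul trmxK.
  rewrite mulmxBr mulmxBl -scalemxAr -scalemxAl !mulmxA.
  rewrite -(mulmxA _ P^T) -(mulmxA _ R^T) -!trmx_mul -GE -dE.
  rewrite GA tr_scalar_mx mul_mx_scalar mul_scalar_mx.
  by rewrite scalerA subrr.
apply: (isotropic_graph (P := map_mx (horner_eval 0) P)
  (R := map_mx (horner_eval 0) R) ch2 uB BT CT).
  move=> c cP cR; apply: (row_free_inj fPR).
  by rewrite mul0mx map_row_mx mul_mx_row cP cR row_mx0.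
(* At 0 both sides carry the nonzero factor [b.[0]]. *)
move/(congr1 (map_mx (horner_eval 0))): PAR.
rewrite map_mxZ !map_mxM !map_trmx horner_eval_polyC_mx A0.
rewrite -scalemxAr -scalemxAl; exact: scalerI.
Qed.
End Saturation.

(** This splits off the radical: [A] gives coordinates modulo the radical of [M]. With [L] a right
    inverse of [A], symmetry lets [L A] be absorbed on both sides, so [N = L^T M L]; its rank is at
    least that of [M], which is [r]. *)
Lemma symmx_row_base (F : fieldType) n (M : 'M[F]_n) : M^T = M ->
  exists r (N : 'M[F]_r) (A : 'M[F]_(r, n)),
    [/\ row_free A, N \in unitmx, N^T = N & M = A^T *m N *m A].
Proof.
move=> MT.
have [r [C [A [fA ME rM]]]] : exists r (C : 'M[F]_(n, r)) (A : 'M_(r, n)),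
    [/\ row_free A, C *m A = M & r = \rank M].
  exists (\rank M), (col_base M), (row_base M).
  by rewrite row_base_free mulmx_base.
have /row_freeP[L AL] := fA.
have ML : M *m L *m A = M by rewrite -{1}ME -(mulmxA C) AL mulmx1.
have LM : A^T *m L^T *m M = M.
  by apply: trmx_inj; rewrite !trmx_mul !trmxK MT mulmxA.
have NE : M = A^T *m (L^T *m M *m L) *m A by rewrite !mulmxA LM ML.
exists r, (L^T *m M *m L), A; split=> //; first last.
  by rewrite !trmx_mul trmxK MT mulmxA.
rewrite -row_free_unit -row_leq_rank [leqLHS]rM {1}NE.
by apply: leq_trans (mxrankM_maxl _ _) _; apply: mxrankM_maxr.
Qed.

(** * Orders and denominators in F(t) *)

Section Fractions.
Variable F : fieldType.
Local Notation K := {fraction {poly F}}.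

(** Let [k] be the multiplicity of 0 as a root of the representing denominator. Nonnegative order
    makes ['X^k] divide the numerator too, and cancelling it leaves a denominator that does not
    vanish at 0. *)
Lemma ord_ge0P (f : K) : (0 <= ord f)%E ->
  exists p q : {poly F},
    [/\ q.[0] != 0, q%:F * f = p%:F & q.[0] * at0 f = p.[0]].
Proof.
rewrite /ord /at0 => fge0; set k := mup 0 _.
have fd := fraction_numden f.
set n := \n_ _ in fge0 fd *; set d := \d_ _ in fge0 fd k *.
have d0 : d != 0 by exact: denom_ratioP.
have Xk_d : 'X^k %| d by rewrite -['X]subr0 -polyC0 -mup_geq.
have Xk_n : 'X^k %| n.
  case: eqP fge0 => [f0 _ | _].
    have /eqP : n%:F = 0 by rewrite -fd f0 mul0r.
    by rewrite tofrac_eq0 => /eqP ->; apply: dvdp0.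
  have [-> _|n0] := eqVneq n 0; first exact: dvdp0.
  by rewrite lee_fin subr_ge0 lez_nat -['X]subr0 -polyC0 -mup_geq.
have Xk0 : 'X^k != 0 :> {poly F} by rewrite expf_neq0 ?polyX_eq0.
have d'0 : (d %/ 'X^k).[0] != 0.
  apply/negP; rewrite -/(root _ _) root_factor_theorem polyC0 subr0 => dv.
  have : ('X - 0%:P) ^+ k.+1 %| d.
    by rewrite polyC0 subr0 exprSr -(divpK Xk_d) [_ * 'X]mulrC dvdp_mul2r.
  by rewrite -mup_geq // ltnn.
exists (n %/ 'X^k), (d %/ 'X^k); split=> //; first last.
  by rewrite mulrCA divff ?mulr1.
have Xk0' : ('X^k)%:F != 0 :> K by rewrite tofrac_eq0.
by apply: (mulIf Xk0'); rewrite mulrAC -!tofracM !divpK // -fd mulrC.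
Qed.

Lemma at0_tofrac (p : {poly F}) : at0 p%:F = p.[0].
Proof.
by have := @at0E F p 1; rewrite hornerC tofrac1 !divr1; apply; rewrite oner_eq0.
Qed.

(** The representative may have a nontrivial denominator, but its numerator is then [p] times that
    denominator. *)
Lemma ord_tofrac (p : {poly F}) : (0 <= ord p%:F)%E.
Proof.
have := @frac_repr F p%:F p 1 (oner_neq0 _).
rewrite tofrac1 divr1 => /(_ erefl).
rewrite /ord; case: ifP => // /negbT; rewrite tofrac_eq0 mulr1 => p0 ->.
by rewrite mupM ?denom_ratioP // lee_fin PoszD addrAC subrr add0r.
Qed.

Lemma ord_mx_ge0P m n (A : 'M[K]_(m, n)) :
  (0 <= ord_mx A)%E <-> forall i j, (0 <= ord (A i j))%E.
Proof.
split=> [/bigmin_geP[_ Age0] i j | Age0].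
  by have /bigmin_geP[_] := Age0 i isT; apply.
by apply/bigmin_geP; split=> // i _; apply/bigmin_geP; split=> // j _.
Qed.

(** The product itself is exposed because its nonvanishing, as a polynomial or at 0, is later read
    off from its factors. *)
Lemma common_multiple m n (q : 'I_m -> 'I_n -> {poly F}) :
  exists b, (forall i j, q i j %| b) /\ b = \prod_i \prod_j q i j.
Proof.
exists (\prod_i \prod_j q i j); split=> // i j.
by rewrite (bigD1 i) //= (bigD1 j) //= -mulrA dvdp_mulIl.
Qed.

Lemma clear_denominators m n (g : 'M[K]_(m, n)) :
  exists (d : {poly F}) (G : 'M[{poly F}]_(m, n)),
    d != 0 /\ d%:F *: g = map_mx (@FracField.tofrac _) G.
Proof.
have [d [dP dE]] := common_multiple (fun i j => \d_(repr (g i j))).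
exists d, (\matrix_(i, j) ((d %/ \d_(repr (g i j))) * \n_(repr (g i j)))).
split.
  rewrite dE; apply/prodf_neq0 => i _; apply/prodf_neq0 => j _.
  exact: denom_ratioP.
apply/matrixP=> i j; rewrite !mxE tofracM -fraction_numden.
by rewrite mulrCA -tofracM divpK // mulrC.
Qed.

Lemma clear_denominators_at0 m n (g : 'M[K]_(m, n)) : (0 <= ord_mx g)%E ->
  exists (b : {poly F}) (G : 'M[{poly F}]_(m, n)),
    [/\ b.[0] != 0, b%:F *: g = map_mx (@FracField.tofrac _) G &
        map_mx (horner_eval 0) G = b.[0] *: map_mx (@at0 F) g].
Proof.
move=> /ord_mx_ge0P g0.
pose S (f : K) (r : {poly F} * {poly F}) :=
  [/\ r.2.[0] != 0, r.2%:F * f = r.1%:F & r.2.[0] * at0 f = r.1.[0]].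
have /fin_all_exists[pq pqP] (i : 'I_m) :
    exists r : 'I_n -> {poly F} * {poly F}, forall j, S (g i j) (r j).
  apply: (fin_all_exists (P := fun j => S (g i j))) => j.
  by have [p [q pq]] := ord_ge0P (g0 i j); exists (p, q).
have [b [bP bE]] := common_multiple (fun i j => (pq i j).2).
exists b, (\matrix_(i, j) ((b %/ (pq i j).2) * (pq i j).1)); split.
- rewrite bE horner_prod; apply/prodf_neq0 => i _; rewrite horner_prod.
  by apply/prodf_neq0 => j _; case: (pqP i j).
- apply/matrixP=> i j; rewrite !mxE tofracM; case: (pqP i j) => _ <- _.
  by rewrite mulrA -tofracM divpK.
apply/matrixP=> i j; rewrite !mxE /horner_eval hornerM.
by case: (pqP i j) => _ _ <-; rewrite mulrA -hornerM divpK.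
Qed.

Lemma tofrac_mx_inj m n : injective (map_mx (@FracField.tofrac {poly F}) :
  'M_(m, n) -> 'M_(m, n)).
Proof.
move=> A B /matrixP eqAB; apply/matrixP=> i j; have := eqAB i j.
by rewrite !mxE => /eqP; rewrite tofrac_eq => /eqP.
Qed.

(** The radical of [M] is divided out first: the graph argument is applied to the invertible [N] and
    to the family [rb g], which has the same B^t. *)
Lemma contraction_mx n (M : 'M[F]_n) (g : 'M[K]_n) :
  let Bt := g^T *m map_mx (@const_frac F) M *m g in
  2%N \notin [pchar F] -> M^T = M -> (0 <= ord_mx Bt)%E ->
  exists X : 'M[F]_n, X^T *m M *m X = map_mx (@at0 F) Bt.
Proof.
move=> Bt ch2 MT Bt0.
have [r [N [rb [frb uN NT ME]]]] := symmx_row_base MT.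
have [b [A [b0 bBt A0]]] := clear_denominators_at0 Bt0.
have [d [G [d0 dg]]] := clear_denominators g.
have fracM k l (C : 'M[F]_(k, l)) :
    map_mx (@const_frac F) C = map_mx (@FracField.tofrac _) (map_mx polyC C).
  by apply/matrixP=> i j; rewrite !mxE.
have BtT : Bt^T = Bt by rewrite !trmx_mul trmxK map_trmx MT mulmxA.
have [] := @graph_of_contraction _ _ _ N (map_mx (@at0 F) Bt)
   (map_mx polyC rb *m G)^T A b d ch2 uN NT _ d0 b0 _ A0.
- by rewrite map_trmx BtT.
(* Over F(t) both sides equal [d ^+ 2 * b] times [Bt]. *)
- apply: tofrac_mx_inj; set G' := map_mx polyC rb *m G.
  have G'E : map_mx (@FracField.tofrac _) G' =
      d%:F *: (map_mx (@const_frac F) rb *m g).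
    by rewrite map_mxM -dg -scalemxAr fracM.
  clearbody G'; rewrite trmxK !map_mxZ !map_mxM -map_trmx G'E -bBt.
  rewrite rmorphXn /= scalerA mulrC -scalerA.
  congr (_ *: _); rewrite [(_ *: _)^T]linearZ /= -scalemxAr -!scalemxAl scalerA.
  congr (_ *: _).
  by rewrite /Bt {1}ME !fracM !map_mxM trmx_mul -!map_trmx !mulmxA.
move=> X XN; have /row_freeP[L rbL] := frb.
(* The right inverse [L] of [rb] lifts [X^T] from the quotient by the radical. *)
exists (L *m X^T).
rewrite {1}ME -XN !trmx_mul trmxK !mulmxA -(mulmxA X L^T) -trmx_mul rbL trmx1.
by rewrite mulmx1 -(mulmxA _ rb) rbL mulmx1.
Qed.
End Fractions.

Lemma mulmx_trl_entry (F : fieldType) r n (N : 'M[F]_r) (C : 'M[F]_(r, n)) i j :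
  (C^T *m N *m C) i j = ((col i C)^T *m N *m col j C) 0 0.
Proof.
rewrite tr_col -row_mul [LHS]mxE [RHS]mxE.
by apply: eq_bigr => k _; rewrite [X in _ = X * _]mxE [X in _ = _ * X]mxE.
Qed.

(** * Forms pulled back from column vectors along a linear map *)

Section PullbackForm.
Variables (F : fieldType) (V : vectType F) (r : nat).
Variables (N : 'M[F]_r) (f : {linear V -> 'cV[F]_r}).

Definition pullback_bilin (u v : V) : F := ((f u)^T *m N *m f v) 0 0.

Definition pullback_form (u : V) : F := pullback_bilin u u.

Lemma pullback_bilin_is_bilinear :
  bilinear_for (GRing.Scale.Law.clone F F ( *%R ) _)
    (GRing.Scale.Law.clone F F (idfun \; *%R ) _) pullback_bilin.
Proof.
split=> [v|u] a x y; rewrite /pullback_bilin !linearP /=.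
  by rewrite !mulmxDl -!scalemxAl mxE [X in X + _]mxE.
by rewrite mxE [X in X + _]mxE.
Qed.

HB.instance Definition _ := bilinear_isBilinear.Build F V V F
  (GRing.Scale.Law.clone F F ( *%R ) _)
  (GRing.Scale.Law.clone F F (idfun \; *%R ) _)
  pullback_bilin pullback_bilin_is_bilinear.

Hypothesis NT : N^T = N.

Lemma pullback_bilin_sym u v :
  pullback_bilin u v = (-1) ^+ false * idfun (pullback_bilin v u).
Proof.
rewrite expr0 mul1r /=; have := symmx_swap (f u)^T (f v)^T NT.
by rewrite !trmxK.
Qed.

Lemma pullback_quadratic : quadratic_form pullback_form.
Proof.
pose h := isHermitianSesquilinear.Build F V false idfun _ pullback_bilin_sym.
pose B : {symmetric V} := HB.pack pullback_bilin h.
by exists B.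
Qed.

Lemma bilin_pullback u v : 2%N \notin [pchar F] ->
  bilin pullback_form u v = pullback_bilin u v.
Proof.
move=> ch2.
pose h := isHermitianSesquilinear.Build F V false idfun _ pullback_bilin_sym.
pose B : {symmetric V} := HB.pack pullback_bilin h.
exact: (@bilinE _ _ _ B).
Qed.

(** The Gram matrix is [C^T N C], where [C] is the matrix of [f]. The section [s] makes [f] onto:
    coordinates of the [s (delta_mx j 0)] form a right inverse of [C], so neither multiplication
    changes the rank. *)
Lemma qrank_pullback (s : 'cV[F]_r -> V) : 2%N \notin [pchar F] ->
  cancel s f -> qrank pullback_form = \rank N.
Proof.
move=> ch2 sK; rewrite /qrank.
pose C : 'M[F]_(r, \dim {:V}) := \matrix_(i, j) f (vbasis {:V})`_j i 0.
have colC j : col j C = f (vbasis {:V})`_j by apply/colP=> i; rewrite !mxE.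
have -> : gram (vbasis {:V}) pullback_form = C^T *m N *m C.
  by apply/matrixP=> i j; rewrite mxE bilin_pullback // mulmx_trl_entry !colC.
have fC : row_free C.
  apply/row_freeP.
  exists (\matrix_(i, j) coord (vbasis {:V}) i (s (delta_mx j 0))).
  apply/matrixP=> i j; rewrite mxE.
  have := sK (delta_mx j 0); rewrite [s _](coord_vbasis (memvf _)) linear_sum.
  move/matrixP/(_ i 0); rewrite summxE !mxE eqxx andbT => <-.
  by apply: eq_bigr => k _; rewrite linearZ /= !mxE mulrC.
by rewrite mxrankMfree // -mxrank_tr trmx_mul trmxK NT mxrankMfree.
Qed.
End PullbackForm.

(** * Coordinates relative to a basis *)

Section Coordinates.
Variables (F : fieldType) (V : vectType F) (n : nat) (e : n.-tuple V).

Definition cvec (u : V) : 'cV[F]_n := \col_i coord e i u.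

Lemma cvec_is_linear : linear cvec.
Proof. by move=> a u v; apply/colP=> i; rewrite !mxE linearP. Qed.

HB.instance Definition _ :=
  GRing.isLinear.Build F V 'cV[F]_n _ cvec cvec_is_linear.

Definition vec_of (x : 'cV[F]_n) : V := \sum_i x i 0 *: e`_i.

Lemma vec_of_is_linear : linear vec_of.
Proof.
move=> a x y; rewrite /vec_of scaler_sumr -big_split /=.
by apply: eq_bigr => i _; rewrite !mxE scalerDl scalerA.
Qed.

HB.instance Definition _ :=
  GRing.isLinear.Build F 'cV[F]_n V _ vec_of vec_of_is_linear.

Hypothesis e_basis : basis_of {:V} e.

Lemma cvecK : cancel cvec vec_of.
Proof.
move=> u; rewrite [RHS](coord_basis e_basis (memvf u)).
by apply: eq_bigr => i _; rewrite mxE.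
Qed.

Lemma vec_ofK : cancel vec_of cvec.
Proof.
move=> x; apply/colP=> i; rewrite mxE coord_sum_free //.
exact: basis_free e_basis.
Qed.

Lemma gram_sym (Q : V -> F) : (gram e Q)^T = gram e Q.
Proof.
apply/matrixP=> i j; rewrite !mxE /bilin addrAC; congr ((Q _ - _ - _) / _).
exact: addrC.
Qed.

Lemma form_gram (Q : V -> F) : 2%N \notin [pchar F] -> quadratic_form Q ->
  Q =1 pullback_form (gram e Q) cvec.
Proof.
move=> ch2 [B QB] u; rewrite QB.
transitivity (\sum_i \sum_j cvec u i 0 * (cvec u j 0 * B e`_i e`_j)).
  rewrite -{1 2}[u]cvecK /vec_of linear_sumlz; apply: eq_bigr => i _.
  rewrite linearZl_LR /= linear_sum mulr_sumr; apply: eq_bigr => j _.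
  by rewrite linearZ.
rewrite /pullback_form /pullback_bilin mxE exchange_big /=.
apply: eq_bigr => j _.
rewrite [X in _ = X * _]mxE mulr_suml; apply: eq_bigr => i _.
by rewrite !mxE (bilinE ch2 QB) mulrA mulrAC.
Qed.

End Coordinates.

Section Forms.
Variable F : fieldType.
Hypothesis ch2 : 2%N \notin [pchar F].

Lemma eq_quadratic_form (V : vectType F) (Q1 Q2 : V -> F) :
  Q1 =1 Q2 -> quadratic_form Q2 -> quadratic_form Q1.
Proof. by move=> Q12 [B QB]; exists B => u; rewrite Q12. Qed.

Lemma eq_gram (V : vectType F) n (e : n.-tuple V) (Q1 Q2 : V -> F) :
  Q1 =1 Q2 -> gram e Q1 = gram e Q2.
Proof. by move=> Q12; apply/matrixP=> i j; rewrite !mxE /bilin !Q12. Qed.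

Lemma eq_qrank (V : vectType F) (Q1 Q2 : V -> F) :
  Q1 =1 Q2 -> qrank Q1 = qrank Q2.
Proof. by move=> Q12; rewrite /qrank (eq_gram _ Q12). Qed.

Lemma qrank_eq0 (V : vectType F) (Q : V -> F) :
  quadratic_form Q -> qrank Q = 0%N -> Q =1 fun=> 0.
Proof.
move=> hQ /eqP; rewrite mxrank_eq0 => /eqP g0 u.
rewrite (form_gram (vbasisP _) ch2 hQ) /pullback_form /pullback_bilin g0.
by rewrite mulmx0 mul0mx mxE.
Qed.

Lemma qrank0 (V : vectType F) (Q : V -> F) : Q =1 (fun=> 0) -> qrank Q = 0%N.
Proof.
move=> Q0; rewrite (eq_qrank Q0) /qrank; apply/eqP; rewrite mxrank_eq0.
by apply/eqP/matrixP=> i j; rewrite !mxE /bilin !subr0 mul0r.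
Qed.

Lemma quadratic_form0 (V : vectType F) (Q : V -> F) :
  quadratic_form Q -> Q 0 = 0.
Proof. by move=> [B ->]; rewrite linear0. Qed.

(** * Orthogonal complement of a nonsingular subspace *)

Section OrthogonalComplement.
Variables (V : vectType F) (n : nat) (e : n.-tuple V).
Hypothesis e_basis : basis_of {:V} e.
Variables (Q : V -> F) (hQ : quadratic_form Q) (r : nat) (Y : 'M[F]_(n, r)).
Let M := gram e Q.
Let N := Y^T *m M *m Y.
Hypothesis uN : N \in unitmx.

(** Orthogonal projection onto the span of the columns of [Y], expressed in the coordinates given by
    these columns; its kernel is the orthogonal complement. *)
Definition orth_proj : {linear V -> 'cV[F]_r} :=
  mulmx (invmx N *m Y^T *m M) \o cvec e.

Let i : {linear 'cV[F]_r -> V} := vec_of e \o mulmx Y.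

Let W := subvs_of (lker (linfun orth_proj)).

Let orth_projK : cancel i orth_proj.
Proof.
move=> y; rewrite /= vec_ofK // mulmxA -(mulmxA (invmx N)) -(mulmxA (invmx N)).
by rewrite mulVmx // mul1mx.
Qed.

Let ker_proj u : u - i (orth_proj u) \in lker (linfun orth_proj).
Proof. by rewrite memv_ker lfunE linearB orth_projK subrr. Qed.

Let split_fun (u : V) : 'cV[F]_r * W :=
  (orth_proj u, vsproj (lker (linfun orth_proj)) (u - i (orth_proj u))).

Let split_fun_linear : linear split_fun.
Proof.
move=> a u v; congr (_, _); first by rewrite linearP.
have -> : a *: u + v - i (orth_proj (a *: u + v)) =
    a *: (u - i (orth_proj u)) + (v - i (orth_proj v)).
  by rewrite (linearP orth_proj) (linearP i) scalerBr opprD addrACA.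
exact: linearP.
Qed.

Lemma dim_orth_complement : \dim {:W} = (\dim {:V} - r)%N.
Proof.
have := limg_ker_dim (linfun orth_proj) fullv; rewrite capfv.
have -> : limg (linfun orth_proj) = fullv.
  apply/eqP; rewrite eqEsubv subvf; apply/subvP => y _.
  by rewrite -[y]orth_projK -lfunE memv_img ?memvf.
rewrite (dimvf _) dim_matrix mulr1 => <-; rewrite addnK; exact: dimvf.
Qed.

(** A vector is sent to its projection and the remainder; the values of [Q] add up because the two
    pieces are orthogonal. *)
Lemma orth_complement_split :
  equivalent Q (orth_sum (pullback_form N idfun) (Q \o vsval : W -> F)).
Proof.
pose phi : {linear V -> ('cV[F]_r * W)%type} :=
  HB.pack split_fun (GRing.isLinear.Build F V _ _ split_fun split_fun_linear).
exists phi; split.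
  exists (fun yw => i yw.1 + vsval yw.2) => [u | [y w]] /=.
    by rewrite vsprojK ?ker_proj // addrC subrK.
  have w0 : orth_proj (vsval w) = 0.
    by have := subvsP w; rewrite memv_ker lfunE => /eqP.
  rewrite /split_fun linearD w0 orth_projK addr0; congr (_, _).
  by rewrite addrC addKr vsvalK.
move=> u.
have -> : orth_sum (pullback_form N idfun) (Q \o vsval : W -> F) (phi u) =
    pullback_form N idfun (orth_proj u) + Q (u - i (orth_proj u)).
  by rewrite /orth_sum /= vsprojK ?ker_proj.
have := ker_proj u; rewrite memv_ker lfunE.
set y := orth_proj u; set w := u - i y => /eqP w0.
have -> : u = i y + w by rewrite addrC subrK.
have QE v : Q v = ((cvec e v)^T *m M *m cvec e v) 0 0.
  by rewrite {1}(form_gram e_basis ch2 hQ).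
rewrite !QE /pullback_form /pullback_bilin.
have -> : cvec e (i y + w) = Y *m y + cvec e w by rewrite linearD /= vec_ofK.
(* [Y^T M] applied to [w] is [N] times its projection, which is 0. *)
have yw : (Y *m y)^T *m M *m cvec e w = 0.
  rewrite trmx_mul -!mulmxA.
  have -> : Y^T *m (M *m cvec e w) = N *m orth_proj w.
    by rewrite /= !mulmxA mulmxV // mul1mx.
  by rewrite w0 !mulmx0.
have wy : (cvec e w)^T *m M *m (Y *m y) = 0.
  rewrite -[RHS]trmx0 -yw [RHS]trmx_mul [X in _ = _ *m X]trmx_mul.
  by rewrite trmxK gram_sym [RHS]mulmxA.
rewrite [(_ + _)^T]linearD /= mulmxDl mulmxDl !mulmxDr yw wy addr0 add0r mxE.
by rewrite trmx_mul /N !mulmxA.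
Qed.
End OrthogonalComplement.

(** * Gram matrix congruences, representations and contractions *)

Section Representation.
Variables (V : vectType F) (n : nat) (e : n.-tuple V).
Hypothesis e_basis : basis_of {:V} e.

Lemma bilin_gram (Q : V -> F) u v : quadratic_form Q ->
  bilin Q u v = ((cvec e u)^T *m gram e Q *m cvec e v) 0 0.
Proof.
move=> hQ; have := bilin_pullback (cvec e) (gram_sym e Q) u v ch2.
by rewrite /bilin -!(form_gram e_basis ch2 hQ) => ->.
Qed.

Lemma cvec_basis (j : 'I_n) : cvec e e`_j = delta_mx j 0.
Proof.
apply/colP=> i; rewrite !mxE coord_free ?(basis_free e_basis) //.
by rewrite andbT eq_sym.
Qed.

Lemma gram_form_of_mx (M : 'M[F]_n) : M^T = M -> gram e (form_of_mx e M) = M.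
Proof.
move=> MT; apply/matrixP=> i j; rewrite mxE.
rewrite [LHS](bilin_pullback (cvec e) MT _ _ ch2) /pullback_bilin /=.
by rewrite !cvec_basis trmx_delta -rowE -colE !mxE.
Qed.

(** The columns of [L] span a complement of the radical of [Q'] with Gram matrix [N], and those of
    [X L] have the same Gram matrix for [Q]. Splitting each form along these columns yields the
    nonsingular part of [Q'] and the summand [Q'']. *)
Lemma represents_gram (Q Q' : V -> F) (X : 'M[F]_n) :
  quadratic_form Q -> quadratic_form Q' ->
  X^T *m gram e Q *m X = gram e Q' -> represents Q Q'.
Proof.
move=> hQ hQ' XE.
have [r [N [A [fA uN NT M'E]]]] := symmx_row_base (gram_sym e Q').
have /row_freeP[L AL] := fA.
have LT : L^T *m gram e Q' *m L = N.
  by rewrite M'E !mulmxA -trmx_mul AL trmx1 mul1mx -mulmxA AL mulmx1.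
have XLT : (X *m L)^T *m gram e Q *m (X *m L) = N.
  by rewrite trmx_mul !mulmxA -!(mulmxA L^T) XE !mulmxA.
have Q'E : Q' =1 pullback_form N (mulmx A \o cvec e).
  move=> u; rewrite (form_gram e_basis ch2 hQ') /pullback_form /pullback_bilin.
  by rewrite M'E /= trmx_mul !mulmxA.
have rQ' : qrank Q' = r.
  rewrite (eq_qrank Q'E).
  rewrite (@qrank_pullback _ _ _ _ _ NT (vec_of e \o mulmx L) ch2).
    exact: mxrank_unit.
  by move=> y; rewrite /= vec_ofK // mulmxA AL mul1mx.
have hN : quadratic_form (pullback_form N idfun) by exact: pullback_quadratic.
have sub_quad (Q1 : V -> F) (U : {vspace V}) : quadratic_form Q1 ->
    quadratic_form (Q1 \o vsval : subvs_of U -> F).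
  move=> hQ1; pose Q2 := pullback_form (gram e Q1) (cvec e \o @vsval _ _ U).
  apply: (eq_quadratic_form (Q2 := Q2)).
    by move=> w; rewrite /= (form_gram e_basis ch2 hQ1).
  by apply: pullback_quadratic; apply: gram_sym.
exists 'cV[F]_r, (pullback_form N idfun).
exists (subvs_of (lker (linfun (orth_proj e Q (X *m L))))), (Q \o vsval).
split.
- split=> //.
    rewrite /nonsingular (@qrank_pullback _ _ _ _ _ NT idfun ch2) //.
    by rewrite mxrank_unit // dimvf dim_matrix mulr1.
  exists (subvs_of (lker (linfun (orth_proj e Q' L)))), (Q' \o vsval); split.
  + exact: sub_quad.
  + apply: qrank0 => w /=; rewrite Q'E.
    have := subvsP w; move: (vsval w) => v; rewrite memv_ker lfunE /= => /eqP.
    (* The matrix of this projection simplifies to [A], so its kernel is the radical of [Q']. *)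
    rewrite LT M'E !mulmxA -(mulmxA (invmx N)) -trmx_mul AL trmx1 mulmx1.
    rewrite mulVmx // mul1mx => Aw.
    by rewrite /pullback_form /pullback_bilin /= Aw mulmx0 mxE.
  have := @orth_complement_split _ _ e e_basis _ hQ' _ L.
  by rewrite LT; apply.
- exact: sub_quad.
- by rewrite dim_orth_complement ?XLT // rQ'.
have := @orth_complement_split _ _ e e_basis _ hQ _ (X *m L).
by rewrite XLT; apply.
Qed.

(** The map [a] projects onto the nonsingular part of [Q'] and embeds that part into [Q]; it
    preserves values because the form on the discarded part vanishes. *)
Lemma gram_represents (Q Q' : V -> F) : quadratic_form Q -> represents Q Q' ->
  exists X : 'M[F]_n, X^T *m gram e Q *m X = gram e Q'.
Proof.
move=> hQ [N [Q'N [W [Q'' []]]]].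
move=> [_ _ [Z [QZ [hQZ rQZ [phi [_ Q'E]]]]]] hQ'' _.
move=> [psi [[psi' psiK psi'K] QE]].
pose a u := psi' ((phi u).1, 0).
have aD u v : a (u + v) = a u + a v.
  apply: (can_inj psiK); rewrite linearD !psi'K linearD /=.
  by congr (_, _); rewrite addr0.
have Qa u : Q (a u) = Q' u.
  by rewrite QE psi'K Q'E /orth_sum /= (quadratic_form0 hQ'') (qrank_eq0 hQZ).
pose X : 'M[F]_n := \matrix_(i, j) cvec e (a e`_j) i 0.
have colX j : col j X = cvec e (a e`_j) by apply/colP=> i; rewrite !mxE.
exists X; apply/matrixP=> i j; rewrite mulmx_trl_entry !colX -bilin_gram // mxE.
(* Polarization involves only sums and values, so additivity of [a] suffices. *)
by rewrite /bilin -aD !Qa.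
Qed.

(** The family is polynomial in t, so orders are nonnegative and the value at 0 is obtained by
    evaluation. *)
Lemma contraction_of_gram (Q Q' : V -> F) (X : 'M[F]_n) : quadratic_form Q' ->
  X^T *m gram e Q *m X = gram e Q' -> contraction e Q Q'.
Proof.
move=> hQ' XE.
pose G : 'M[{poly F}]_n := map_mx polyC X + 'X *: map_mx polyC (1%:M - X).
pose H := G^T *m map_mx polyC (gram e Q) *m G.
have BtE : (map_mx (@FracField.tofrac _) G)^T *m
    map_mx (@const_frac F) (gram e Q) *m map_mx (@FracField.tofrac _) G =
    map_mx (@FracField.tofrac _) H.
  rewrite !map_mxM !map_trmx; congr (_ *m _ *m _).
  by apply/matrixP=> i j; rewrite !mxE.
exists (map_mx (@FracField.tofrac _) G); rewrite BtE /=; split.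
- rewrite det_map_mx tofrac_eq0; apply/negP => /eqP/(congr1 (horner_eval 1)).
  rewrite -det_map_mx map_mxD map_mxZ !horner_eval_polyC_mx /= /horner_eval.
  rewrite hornerX scale1r addrC subrK det1 horner0 => /eqP.
  by rewrite oner_eq0.
- by apply/ord_mx_ge0P => i j; rewrite mxE ord_tofrac.
have -> : map_mx (@at0 F) (map_mx (@FracField.tofrac _) H) = gram e Q'.
  have -> : gram e Q' = map_mx (horner_eval 0) H.
    rewrite !map_mxM -map_trmx map_mxD map_mxZ !horner_eval_polyC_mx.
    by rewrite /= /horner_eval hornerX scale0r addr0 XE.
  by apply/matrixP=> i j; rewrite !mxE at0_tofrac.
exact: form_gram.
Qed.

Lemma gram_of_contraction (Q Q' : V -> F) : contraction e Q Q' ->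
  exists X : 'M[F]_n, X^T *m gram e Q *m X = gram e Q'.
Proof.
move=> [g [_ Bt0 Q'E]]; have [X XE] := contraction_mx ch2 (gram_sym e Q) Bt0.
exists X; rewrite (eq_gram e Q'E) gram_form_of_mx -XE //.
by rewrite !trmx_mul trmxK gram_sym mulmxA.
Qed.

End Representation.
End Forms.

Theorem theorem2 (F : fieldType) (F_infinite : infinite_set [set: F]%classic)
    (char_neq2 : 2%N \notin [pchar F])
    (V : vectType F) (e : (\dim {:V}).-tuple V) (e_basis : basis_of {:V} e)
    (Q Q' : V -> F) (hQ : quadratic_form Q) (hQ' : quadratic_form Q') :
  contraction e Q Q' <-> represents Q Q'.
Proof.
split=> [/(gram_of_contraction char_neq2 e_basis)[X XE]|].
  exact: (represents_gram char_neq2 e_basis hQ hQ' XE).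
move=> /(gram_represents char_neq2 e_basis hQ)[X XE].
exact: (contraction_of_gram char_neq2 e_basis hQ' XE).
Qed.
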